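(* For all integers $n\ge0$, the total number of inversions over all derangements of $[n]$ is $$t_n^{(1)}=\frac{n!}{12}\sum_{k=0}^{n-1}(-1)^k\frac{(3n+k)(n-k-1)}{k!}.$$
   Context: A derangement of $[n]$ is a permutation $\pi$ of $[n]=\{1,\dots,n\}$ with $\pi_i\ne i$ for all $i$. For a permutation $\pi$, $\mathrm{inv}(\pi)=|\{(i,j):i<j,\ \pi_i>\pi_j\}|$. $t_n^{(1)}=\sum_{\pi}\mathrm{inv}(\pi)$, the sum over all derangements $\pi$ of $[n]$. *)

(* Defs.v *)
From mathcomp Require Export all_boot all_order all_fingroup all_algebra.

Set Implicit Arguments.
Unset Strict Implicit.
Unset Printing Implicit Defensive.

(* Permutations of [n] = {1, ..., n} are taken as 'S_n, i.e. on {0, ..., n-1};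
   the order-preserving shift by one changes neither fixed points nor
   inversions. *)

Definition derangement (n : nat) (s : 'S_n) : bool :=
  [forall i : 'I_n, s i != i].

Definition inv (n : nat) (s : 'S_n) : nat :=
  #|[set ij : 'I_n * 'I_n | (ij.1 < ij.2)%N && (s ij.1 > s ij.2)%N]|.

Definition t1 (n : nat) : nat := \sum_(s : 'S_n | derangement s) inv s.

(* Main.v *)
(* Sieve over the sets S of prescribed fixed points. Let m = n - |S| and let s
   range over the m! permutations fixing S pointwise. A pair i < j avoiding S is
   inverted by half of them. If exactly one of i, j lies in S, the value at the
   other one is equidistributed over the complement of S, so the inversions are
   counted, with weight (m-1)!, by triples u < v < w with v in S and u, w outside
   S, each triple arising twice. Summing over S for a fixed pair or triple, the
   total is
     sum_k (-1)^k (C(n-2, k) C(n, 2) m!/2 + 2 C(n-3, k-1) C(n, 3) (m-1)!),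
   with m = n - k, and the k-th term simplifies to
   (-1)^k n!/k! (m-1) (3m + 4k) / 12. *)
Require Import Defs.
From mathcomp Require Import zify ring lra.

Set Implicit Arguments.
Unset Strict Implicit.
Unset Printing Implicit Defensive.

Import GRing.Theory Num.Theory.
Local Open Scope ring_scope.

(** * Alternating sums over sets of prescribed fixed points *)

Lemma sum_subsets (V : zmodType) (T : finType) (A : {set T}) (g : nat -> V) :
  \sum_(B : {set T} | B \subset A) g #|B| =
  \sum_(k < #|A|.+1) g k *+ 'C(#|A|, k).
Proof.
pose card_ord (B : {set T}) : 'I_#|A|.+1 := inord #|B|.
have card_ordE (B : {set T}) : B \subset A -> card_ord B = #|B| :> nat.
  by move=> /subset_leq_card leBA; rewrite inordK.
rewrite (partition_big card_ord xpredT) //=; apply: eq_bigr => k _.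
rewrite -cards_draws -sumr_const; apply: eq_big => [B|B].
  by rewrite inE; case: (boolP (B \subset A)) => //= /card_ordE <-.
by case/andP => /card_ordE <- /eqP ->.
Qed.

(** Deleting [x] matches these sets with the subsets of [A :\ x], each one element smaller; hence
    the shift to [g k.+1]. *)
Lemma sum_subsets_mem (V : zmodType) (T : finType) (A : {set T}) (x : T)
    (g : nat -> V) :
  x \in A ->
  \sum_(B : {set T} | (B \subset A) && (x \in B)) g #|B| =
  \sum_(k < #|A|) g k.+1 *+ 'C(#|A|.-1, k).
Proof.
move=> xA; have cardA : #|A| = #|A :\ x|.+1 by rewrite (cardsD1 x) xA.
rewrite (reindex_onto (setU [set x]) (fun B : {set T} => B :\ x));
  last by move=> B /andP[_]; exact: setD1K.
rewrite cardA /= -(sum_subsets _ (fun k => g k.+1)); apply: eq_big => [B|B].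
  rewrite subUset sub1set xA setU11 andbT /= subsetD1; congr (_ && _).
  apply/eqP/idP => [<-|]; last exact: setU1K.
  by rewrite !inE eqxx.
case/andP => _ /eqP BE.
by rewrite cardsU1 -BE !inE eqxx.
Qed.

(* The sum is [(1 - 1) ^+ #|F|] for [F] the set of fixed points of [s]. *)
Lemma derangement_sieve (R : comNzRingType) (n : nat) (s : 'S_n) :
  (derangement s)%:R =
  \sum_(S : {set 'I_n}) (-1) ^+ #|S| * (perm_on (~: S) s)%:R :> R.
Proof.
pose F := [set i | s i == i].
(* Being supported on [~: S] means fixing [S] pointwise. *)
have FE (S : {set 'I_n}) : perm_on (~: S) s = (S \subset F).
  apply/subsetP/subsetP => [sS i iS | SF i].
    by rewrite inE; apply: contraTT iS => /sS; rewrite inE.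
  by rewrite !inE; apply: contraNN => /SF; rewrite inE.
under eq_bigr => S _ do rewrite FE mulr_natr mulrb.
rewrite -big_mkcond sum_subsets.
transitivity ((1 - 1) ^+ #|F| : R); last first.
  rewrite exprDn; apply: eq_bigr => k _.
  by rewrite expr1n mul1r.
rewrite subrr expr0n cards_eq0; congr (nat_of_bool _)%:R.
apply/forallP/eqP => [ds|F0 i].
  by apply/setP=> i; rewrite !inE (negbTE (ds i)).
by have := in_set0 i; rewrite -F0 inE => ->.
Qed.

(** * Permutations supported on a given set *)

Lemma card_perm_on_value (T : finType) (A : {set T}) (x y : T) :
  x \in A -> y \in A ->
  #|[pred s | perm_on A s & s x == y]| = #|A|.-1`!.
Proof.
move=> xA yA; have -> : #|A|.-1 = #|A :\ x| by rewrite (cardsD1 x A) xA.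
rewrite -card_perm -!sum1_card.
(* [s * tperm x y] maps [x] to [y] iff [s] fixes [x]. *)
rewrite (reindex_inj (mulIg (tperm x y))) /=; apply: eq_bigl => s.
have tA : perm_on A (tperm x y).
  by apply: (subset_trans (tperm_on x y)); apply/subsetP=> z /set2P[] ->.
rewrite !inE permM (can2_eq (tpermK x y) (tpermK x y)) tpermR.
have -> : perm_on A (s * tperm x y)%g = perm_on A s.
  apply/idP/idP => [sA|sA]; last exact: perm_onM.
  by rewrite -(mulgK (tperm x y) s) tpermV perm_onM.
apply/andP/subsetP => [[/subsetP sA /eqP sx] z|sA].
  rewrite !inE => sz; rewrite sA ?inE // andbT.
  by apply: contraNneq sz => ->; apply/eqP.
split; first by apply/subsetP => z /sA; rewrite inE => /andP[].
by apply/negPn/negP => sx; have := sA x sx; rewrite !inE eqxx.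
Qed.

(** The value at [x] is equidistributed over [A]. *)
Lemma sum_perm_on_value (n : nat) (A : {set 'I_n}) (x : 'I_n) (P : pred 'I_n) :
  x \in A ->
  \sum_(s | perm_on A s) (P (s x))%:R =
  \sum_(v in A | P v) (#|A|.-1)`!%:R :> rat.
Proof.
move=> xA.
rewrite (partition_big (fun s : 'S_n => s x) [in A]) /=; last first.
  by move=> s sA; rewrite perm_closed.
rewrite [RHS]big_mkcondr; apply: eq_bigr => v vA.
rewrite -(card_perm_on_value xA vA) -sumr_const.
case: ifP => Pv; [apply: eq_bigr | apply: big1];
  by move=> s /andP[_ /eqP ->]; rewrite Pv.
Qed.

Lemma sum_perm_on_inv_both (n : nat) (A : {set 'I_n}) (i j : 'I_n) :
  i \in A -> j \in A -> i != j ->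
  \sum_(s | perm_on A s) (s j < s i)%N%:R = #|A|`!%:R / 2 :> rat.
Proof.
move=> iA jA ij.
have tA : perm_on A (tperm i j).
  by apply: (subset_trans (tperm_on i j)); apply/subsetP=> z /set2P[] ->.
have swap : \sum_(s | perm_on A s) (s j < s i)%N%:R =
            \sum_(s | perm_on A s) (s i < s j)%N%:R :> rat.
  (* Exchanging the values at [i] and [j] pairs inverted with non-inverted. *)
  rewrite (reindex_inj (mulgI (tperm i j))) /=; apply: eq_big => [s|s _].
    apply/idP/idP => [sA|sA]; last exact: perm_onM.
    by rewrite -(mulKg (tperm i j) s) tpermV perm_onM.
  by rewrite !permM tpermL tpermR.
suff E : \sum_(s | perm_on A s) (s j < s i)%N%:R +
         \sum_(s | perm_on A s) (s j < s i)%N%:R = #|A|`!%:R :> rat by lra.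
(* After [swap], each [s] contributes exactly 1, because [s i] and [s j] differ. *)
rewrite {2}swap -big_split /= -card_perm -sumr_const; apply: eq_bigr => s _.
have : s i != s j by rewrite (inj_eq perm_inj).
by rewrite -val_eqE /=; case: ltngtP.
Qed.

(** A point outside [A] is fixed. If only [j] can move, the pair is inverted when the value [v] of
    [s j] is below [i]; if only [i] can move, when the value [v] of [s i] is above [j]; if neither
    can, never. *)
Lemma sum_perm_on_inv (n : nat) (A : {set 'I_n}) (i j : 'I_n) :
  (i < j)%N ->
  \sum_(s | perm_on A s) (s j < s i)%N%:R =
  (if (i \in A) && (j \in A) then #|A|`!%:R / 2 else 0)
  + (\sum_(v : 'I_n | (v < i)%N) if [&& v \in A, j \in A & i \notin A]
                          then #|A|.-1`!%:R else 0)
  + (\sum_(v : 'I_n | (j < v)%N) if [&& i \in A, v \in A & j \notin A]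
                          then #|A|.-1`!%:R else 0) :> rat.
Proof.
move=> ltij; have ij : i != j by rewrite -val_eqE ltn_eqF.
case: (boolP (i \in A)) => iA; case: (boolP (j \in A)) => jA /=.
- rewrite (sum_perm_on_inv_both iA jA ij) !big1 ?addr0 //;
    by move=> v _; rewrite andbF.
- rewrite [X in _ = _ + X + _]big1 ?add0r => [|v _]; last by rewrite andbF.
  under [RHS]eq_bigr do rewrite andbT.
  rewrite -big_mkcondr /= (eq_bigl _ _ (fun v => andbC _ _)).
  rewrite -(sum_perm_on_value (fun v : 'I_n => (j < v)%N) iA) /=.
  by apply: eq_bigr => s sA; rewrite (out_perm sA jA).
- rewrite [X in _ = _ + _ + X]big1 ?add0r ?addr0 //.
  under [RHS]eq_bigr do rewrite andbT.
  rewrite -big_mkcondr /= (eq_bigl _ _ (fun v => andbC _ _)).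
  rewrite -(sum_perm_on_value (fun v : 'I_n => (v < i)%N) jA) /=.
  by apply: eq_bigr => s sA; rewrite (out_perm sA iA).
rewrite !big1 ?addr0 // => [v _|s sA]; first by rewrite andbF.
by rewrite (out_perm sA iA) (out_perm sA jA) ltnNge ltnW.
Qed.

(** * Sums over increasing pairs and triples, largest index outermost *)

Lemma invE (n : nat) (s : 'S_n) :
  inv s = (\sum_(j < n) \sum_(i < n | i < j) (s j < s i))%N.
Proof.
rewrite /inv -sum1_card pair_big_dep /=.
rewrite (reindex_inj (h := fun ij : 'I_n * 'I_n => (ij.2, ij.1))) /=;
  last by move=> [a b] [c d] [-> ->].
rewrite [RHS]big_mkcond [LHS]big_mkcond; apply: eq_bigr => -[a b] _.
by rewrite inE /=; case: (b < a)%N; case: (_ < _)%N.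
Qed.

Lemma sum_lt (V : zmodType) (n : nat) (x : V) (j : 'I_n) :
  \sum_(i < n | (i < j)%N) x = x *+ j.
Proof.
by rewrite -(big_ord_widen n (fun=> x) (ltnW (ltn_ord j))) sumr_const card_ord.
Qed.

Lemma sum_lt_pairs (V : zmodType) (n : nat) (x : V) :
  \sum_(j < n) \sum_(i < n | (i < j)%N) x = x *+ 'C(n, 2).
Proof.
under eq_bigr do rewrite sum_lt.
by rewrite sumrMnr -bin2_sum big_mkord.
Qed.

Lemma sum_lt_triples (V : zmodType) (n : nat) (x : V) :
  \sum_(j < n) \sum_(i < n | (i < j)%N) \sum_(v < n | (v < i)%N) x =
  x *+ 'C(n, 3).
Proof.
(* Hockey-stick identity: [j] is the largest element of the triple. *)
have -> : 'C(n, 3) = (\sum_(j < n) 'C(j, 2))%N.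
  by elim: n => [|n IH]; rewrite ?big_ord0 // big_ord_recr binS IH.
rewrite -sumrMnr; apply: eq_bigr => j _.
under eq_bigr do rewrite sum_lt.
rewrite -(big_ord_widen n (fun i => x *+ i) (ltnW (ltn_ord j))).
by rewrite sumrMnr -bin2_sum big_mkord.
Qed.

(** Moves the largest index [v] outermost, the shape that [sum_lt_triples] evaluates. *)
Lemma exchange_lt_triples (V : zmodType) (n : nat)
    (F : 'I_n -> 'I_n -> 'I_n -> V) :
  \sum_(j < n) \sum_(i < n | (i < j)%N) \sum_(v < n | (j < v)%N) F i j v =
  \sum_(v < n) \sum_(j < n | (j < v)%N) \sum_(i < n | (i < j)%N) F i j v.
Proof.
rewrite [RHS](exchange_big_dep xpredT) //=.
by apply: eq_bigr => j _; apply: exchange_big.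
Qed.

(** * Summing over the fixed sets for given positions *)

Lemma subset_setC2 (T : finType) (S : {set T}) (x y : T) :
  (S \subset ~: [set x; y]) = (x \in ~: S) && (y \in ~: S).
Proof.
by rewrite -disjoints_subset disjoint_sym disjoints_subset subUset !sub1set.
Qed.

Lemma sum_sets_avoiding_pair (n : nat) (i j : 'I_n) (F : nat -> rat) :
  i != j ->
  \sum_(S : {set 'I_n}) (-1) ^+ #|S| *
     (if (i \in ~: S) && (j \in ~: S) then F #|~: S| else 0) =
  \sum_(k < (n - 2).+1) ((-1) ^+ k * F (n - k)%N) *+ 'C(n - 2, k).
Proof.
move=> ij; have cardA : #|~: [set i; j]| = (n - 2)%N.
  by rewrite cardsCs setCK cards2 ij card_ord.
have := sum_subsets (~: [set i; j]) (fun k => (-1) ^+ k * F (n - k)%N).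
rewrite cardA => <-; rewrite [RHS]big_mkcond; apply: eq_bigr => S _.
have cardS : #|~: S| = (n - #|S|)%N by rewrite cardsCs setCK card_ord.
by rewrite subset_setC2 cardS; case: ifP => // _; rewrite mulr0.
Qed.

(** [S] contains the middle point [i] and avoids both ends; [k] counts its other elements, drawn
    from the remaining [n - 3] points. *)
Lemma sum_sets_separating (n : nat) (i j v : 'I_n) (F : nat -> rat) :
  (v < i)%N -> (i < j)%N ->
  \sum_(S : {set 'I_n}) (-1) ^+ #|S| *
     (if [&& v \in ~: S, j \in ~: S & i \notin ~: S] then F #|~: S| else 0) =
  \sum_(k < n - 2) ((-1) ^+ k.+1 * F (n - k.+1)%N) *+ 'C(n - 3, k).
Proof.
move=> vi ij; have vj : v != j by rewrite -val_eqE ltn_eqF // (ltn_trans vi).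
have cardA : #|~: [set v; j]| = (n - 2)%N.
  by rewrite cardsCs setCK cards2 vj card_ord.
have iA : i \in ~: [set v; j].
  by rewrite !inE -!val_eqE (ltn_eqF ij) (gtn_eqF vi).
have := sum_subsets_mem (fun k => (-1) ^+ k * F (n - k)%N) iA.
rewrite cardA -subnS => <-; rewrite [RHS]big_mkcond; apply: eq_bigr => S _.
have cardS : #|~: S| = (n - #|S|)%N by rewrite cardsCs setCK card_ord.
rewrite subset_setC2 cardS.
rewrite [i \in ~: S]inE negbK andbA.
by case: ifP => // _; rewrite mulr0.
Qed.

(** The final [*+ 2] arises because the fixed middle point of a triple may be the left or the right
    position of the inverted pair. *)
Lemma t1E (n : nat) :
  (t1 n)%:R =
  (\sum_(k < (n - 2).+1) ((-1) ^+ k * ((n - k)`!%:R / 2)) *+ 'C(n - 2, k))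
    *+ 'C(n, 2)
  + (\sum_(k < n - 2) ((-1) ^+ k.+1 * (n - k.+1).-1`!%:R) *+ 'C(n - 3, k))
    *+ 'C(n, 3) *+ 2 :> rat.
Proof.
transitivity (\sum_(S : {set 'I_n}) (-1) ^+ #|S| *
  \sum_(j < n) \sum_(i < n | (i < j)%N)
    \sum_(s | perm_on (~: S) s) (s j < s i)%N%:R : rat).
  rewrite /t1 natr_sum big_mkcond /=.
  under eq_bigr => s _ do
    rewrite -mulrb -[_ *+ derangement _]mulr_natr derangement_sieve mulr_sumr.
  rewrite exchange_big; apply: eq_bigr => S _ /=.
  under [in RHS]eq_bigr do rewrite exchange_big.
  rewrite /= exchange_big mulr_sumr [RHS]big_mkcond /=; apply: eq_bigr => s _.
  case: (perm_on _ s); last by rewrite !mulr0.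
  rewrite mulr1 mulrC; congr (_ * _).
  by rewrite invE natr_sum; apply: eq_bigr => j _; rewrite natr_sum.
under eq_bigr => S _ do (rewrite mulr_sumr;
  under eq_bigr => j _ do (rewrite mulr_sumr;
  under eq_bigr => i ij do rewrite (sum_perm_on_inv _ ij) !mulrDr !mulr_sumr)).
set a := \sum_(k < _.+1) _; set b := \sum_(k < _) _.
rewrite exchange_big /=.
(* Once positions are chosen, the sum over [S] depends only on [n]: it is [a] for each pair and [b]
   for each triple. *)
transitivity (\sum_(j < n) \sum_(i < n | (i < j)%N)
  (a + \sum_(v < n | (v < i)%N) b + \sum_(v < n | (j < v)%N) b)).
  apply: eq_bigr => j _; rewrite exchange_big /=; apply: eq_bigr => i ij.
  rewrite !big_split /=; congr (_ + _ + _).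
  - apply: (sum_sets_avoiding_pair (fun m => m`!%:R / 2)).
    by rewrite -val_eqE ltn_eqF.
  - rewrite exchange_big; apply: eq_bigr => v vi.
    exact: (sum_sets_separating (fun m => m.-1`!%:R)).
  - rewrite exchange_big; apply: eq_bigr => v jv.
    exact: (sum_sets_separating (fun m => m.-1`!%:R)).
under eq_bigr do rewrite !big_split /=.
rewrite !big_split /= exchange_lt_triples !sum_lt_triples sum_lt_pairs.
by rewrite mulr2n addrA.
Qed.

(** * Simplification of the general term *)

Lemma fact_neq0 (k : nat) : k`!%:R != 0 :> rat.
Proof. by rewrite pnatr_eq0 -lt0n fact_gt0. Qed.

Lemma natr_bin_add (k l : nat) :
  'C(k + l, k)%:R = (k + l)`!%:R / (k`!%:R * l`!%:R) :> rat.
Proof.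
have /(congr1 (fun m => m%:R : rat)) := bin_fact (leq_addr l k).
rewrite addKn 2!natrM => <-; rewrite mulfK //.
by rewrite mulf_neq0 ?fact_neq0.
Qed.

(** Here [n = k + l + 2], and [l + 2] points lie outside [S]. *)
Lemma pair_term (k l : nat) :
  l.+2`!%:R / 2 * 'C(k + l, k)%:R * 'C(2 + (k + l), 2)%:R =
  (2 + (k + l))`!%:R / 12 * (3 * (l.+2%:R * l.+1%:R / k`!%:R)) :> rat.
Proof.
rewrite !natr_bin_add (factS l.+1) (factS l) (_ : 2`! = 2)%N //.
move: ((2 + (k + l))`!%:R : rat) => N; rewrite !natrM.
have := (fact_neq0 k, fact_neq0 l, fact_neq0 (k + l)).
move: (k`!%:R : rat) (l`!%:R : rat) ((k + l)`!%:R : rat) => a b c.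
by move=> [[a0 b0] c0]; field; rewrite a0 b0 c0.
Qed.

(** Here [n = k + l + 3] and [S] has [k + 1] elements, so again [l + 2] points lie outside [S]. *)
Lemma triple_term (k l : nat) :
  l.+1`!%:R * 'C(k + l, k)%:R * 'C(3 + (k + l), 3)%:R * 2 =
  (3 + (k + l))`!%:R / 12 * (4 * (k.+1%:R * l.+1%:R / k.+1`!%:R)) :> rat.
Proof.
rewrite !natr_bin_add (factS k) (factS l) (_ : 3`! = 6)%N //.
move: ((3 + (k + l))`!%:R : rat) => N; rewrite !natrM.
have := (fact_neq0 k, fact_neq0 l, fact_neq0 (k + l)).
move: (k`!%:R : rat) (l`!%:R : rat) ((k + l)`!%:R : rat) => a b c.
have : k.+1%:R != 0 :> rat by rewrite pnatr_eq0.
by move=> k0 [[a0 b0] c0]; field; rewrite a0 b0 c0 addrC natr1 k0.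
Qed.

Theorem theorem4p1 (n : nat) :
  (t1 n)%:R =
    (n`!)%:R / 12%:R *
    \sum_(0 <= k < n)
      (-1) ^+ k * ((3%:R * n%:R + k%:R) * (n%:R - k%:R - 1)) / (k`!)%:R
  :> rat.
Proof.
rewrite t1E; case: n => [|[|m]].
- by rewrite big_geq // !mulr0n addr0 mulr0.
- by rewrite big_nat1 !mulr0n addr0 subr0 subrr ?mulr0 ?mul0r ?mulr0.
(* Since [3n + k = 3(n - k) + 4k], each term splits into a pair part and a triple part. *)
have split_term k : (-1) ^+ k * ((3%:R * m.+2%:R + k%:R) *
    (m.+2%:R - k%:R - 1)) / (k`!)%:R =
    (-1) ^+ k *
      (3 * ((m.+2%:R - k%:R) * (m.+2%:R - k%:R - 1) / k`!%:R)) +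
    (-1) ^+ k * (4 * (k%:R * (m.+2%:R - k%:R - 1) / k`!%:R)) :> rat.
  by ring.
(* The term [k = n - 1] vanishes, leaving the range of the pair sum. *)
have last0 : m.+2%:R - m.+1%:R - 1 = 0 :> rat.
  by rewrite -[m.+2%:R]natr1; ring.
rewrite big_mkord [X in _ = _ * X]big_ord_recr /= last0 !mulr0 mul0r addr0.
under [X in _ = _ * X]eq_bigr do rewrite split_term.
have -> : (m.+2 - 2 = m)%N by lia.
rewrite [X in _ = _ * X]big_split mulrDr; congr (_ + _); rewrite mulr_sumr.
  rewrite -sumrMnl; apply: eq_bigr => -[k lekm] _.
  have [l mE] : exists l, m = (k + l)%N by exists (m - k)%N; lia.
  have kE : m.+2%:R - k%:R = l.+2%:R :> rat.
    by rewrite -natrB; [congr _%:R|]; lia.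
  have -> : (m.+2 - Ordinal lekm = l.+2)%N by rewrite /=; lia.
  rewrite [nat_of_ord _]/= kE -[l.+2%:R in X in _ = _ * X]natr1 addrK natr1.
  rewrite [RHS]mulrCA; have := pair_term k l.
  rewrite -mE -[(2 + m)%N]/m.+2 => <-.
  by rewrite ![in RHS]mulr_natr !mulrnAr.
(* The factor [k] kills the term [k = 0] of the triple part; the rest is indexed by [k + 1], as in
   [t1E]. *)
rewrite big_ord_recl mul0r !mulr0 add0r.
rewrite -2!sumrMnl; apply: eq_bigr => -[k ltkm] _.
have [l mE] : exists l, m = (k + l).+1 by exists (m - k).-1; lia.
have kE : m.+2%:R - k.+1%:R = l.+2%:R :> rat.
  by rewrite -natrB; [congr _%:R|]; lia.
have -> : (m.+2 - (Ordinal ltkm).+1).-1 = l.+1 by rewrite /=; lia.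
have -> : (m.+2 - 3)%N = (k + l)%N by lia.
rewrite lift0 [nat_of_ord _]/= kE -[l.+2%:R]natr1 addrK.
rewrite [RHS]mulrCA; have := triple_term k l.
rewrite -[(3 + _)%N]/(k + l).+1.+2 -mE => <-.
by rewrite ![in RHS]mulr_natr !mulrnAr.
Qed.
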